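(* Let $k\ge 2$ be an integer and let $\vec c=(c_1,\ldots,c_k)$ be an integer vector with $c_1\ge c_2\ge\cdots\ge c_k$ and $c_k=1$. Let $(\vec X_n)_{n\in\mathbb Z}$ be the $\vec c$-recurrence vector sequence in $\mathbb Z^{k-1}$. Then every $\vec v\in\mathbb Z^{k-1}$ has a unique $\vec c$-satisfying representation; that is, there is exactly one sequence $(a_n)_{n=1}^\infty$ which is a $\vec c$-SR of $\vec v$.
   Context: The $\vec c$-recurrence vector sequence $(\vec X_n)_{n\in\mathbb Z}\subseteq\mathbb Z^{k-1}$ is defined by $\vec X_0=\vec 0$, $\vec X_{-i}=\vec e_i$ (the $i$-th standard basis vector) for $1\le i\le k-1$, and the recurrence $\vec X_n=c_1\vec X_{n-1}+c_2\vec X_{n-2}+\cdots+c_k\vec X_{n-k}$ for all $n\in\mathbb Z$. Since $c_k=1$, for negative indices this means $\vec X_n=\vec X_{n+k}-\sum_{i=1}^{k-1}c_i\vec X_{n+k-i}$ for all $n\le -k$. Satisfying sequences: let $a=(a_n)_{n=1}^\infty$ be a sequence of nonnegative integers with only finitely many nonzero terms. The property that $a$ is a $\vec c$-SR is defined recursively. The zero sequence is a $\vec c$-SR. If $a$ is nonzero, let $m$ be the largest index with $a_m>0$; then $a$ is a $\vec c$-SR if and only if at least one of the following holds: (i) $m<k$ and $a_n=c_n$ for all $1\le n\le m$; (ii) there exist $s\in\{1,\ldots,k\}$ and $\ell\ge 0$ such that $a_1=c_1,\ldots,a_{s-1}=c_{s-1}$, $a_s<c_s$, $a_{s+1}=\cdots=a_{s+\ell}=0$,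 and the shifted sequence $(a_{s+\ell+n})_{n=1}^\infty$ is a $\vec c$-SR. A $\vec c$-satisfying representation ($\vec c$-SR) of $\vec v\in\mathbb Z^{k-1}$ is a sequence $a$ that is a $\vec c$-SR and satisfies $\vec v=\sum_{n\ge1}a_n\vec X_{-n}$. *)

(* Defs.v *)
From mathcomp Require Import all_boot all_order all_algebra.

Set Implicit Arguments.
Unset Strict Implicit.
Unset Printing Implicit Defensive.

Import Order.TTheory GRing.Theory Num.Theory.
Local Open Scope ring_scope.

(* Positions are counted from 0: c`_i is c_{i+1}, and a sequence (a_n)_{n >= 1}
   of nonnegative integers is a : nat -> nat with a n standing for a_{n+1}. *)

Definition is_recurrence_seq (k : nat) (c : k.-tuple int)
    (X : int -> 'rV[int]_k.-1) : Prop :=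
  [/\ X 0 = 0,
      forall i : 'I_k.-1, X (- (i.+1)%:Z) = delta_mx 0 i
    & forall n : int, X n = \sum_(i < k) c`_i *: X (n - (i.+1)%:Z)].

(* The recursion on sequences of finite support is well founded: clause (ii)
   drops the s + l >= 1 leading terms of a. It is therefore the same as the
   inductive predicate, all of whose members have finite support.
   In SR_prefix the largest index with a nonzero term is m.+1, and in SR_block
   the index s of (ii) is s.+1. *)
Inductive satisfying (k : nat) (c : k.-tuple int) : (nat -> nat) -> Prop :=
| SR_zero (a : nat -> nat) of (forall n, a n = 0%N) : satisfying c a
| SR_prefix (a : nat -> nat) (m : nat) of
    (m.+1 < k)%N &
    (0 < a m)%N &
    (forall n, (m < n)%N -> a n = 0%N) &
    (forall n, (n <= m)%N -> (a n)%:Z = c`_n) : satisfying c a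
| SR_block (a : nat -> nat) (s l : nat) of
    (s < k)%N &
    (forall n, (n < s)%N -> (a n)%:Z = c`_n) &
    (a s)%:Z < c`_s &
    (forall n, (s < n <= s + l)%N -> a n = 0%N) &
    satisfying c (fun n => a (s.+1 + l + n)%N) : satisfying c a.

(* The bound N makes the sum over all n >= 1 a finite one. *)
Definition satisfying_repr (k : nat) (c : k.-tuple int)
    (X : int -> 'rV[int]_k.-1) (v : 'rV[int]_k.-1) (a : nat -> nat) : Prop :=
  satisfying c a /\
  exists N : nat, (forall n, (N <= n)%N -> a n = 0%N) /\
    v = \sum_(n < N) X (- (n.+1)%:Z) *+ a n.

Section Existence.

Variables (k : nat) (c : k.-tuple int).
Hypotheses (k2 : (2 <= k)%N) (ck : c`_k.-1 = 1).

Let V : Type := 'rV[int]_k.-1.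

(* A window w holds w i = X (n - i) for i < k. *)
Let fwd (w : nat -> V) (i : nat) : V :=
  if i is j.+1 then w j else \sum_(j < k) c`_j *: w j.

Let bwd (w : nat -> V) (i : nat) : V :=
  if (i < k.-1)%N then w i.+1 else w 0%N - \sum_(j < k.-1) c`_j *: w j.+1.

Let win0 (i : nat) : V := \row_(j < k.-1) (i == j.+1)%:R.

Let win (n : int) : nat -> V :=
  match n with
  | Posz m => iter m fwd win0
  | Negz m => iter m.+1 bwd win0
  end.

Let fwd_bwd w i : (i < k)%N -> fwd (bwd w) i = w i.
Proof.
have k0 : (0 < k)%N by apply: ltn_trans k2.
case: i => [|i] ik /=; last by rewrite /bwd ifT // -ltnS prednK.
rewrite -(big_mkord xpredT (fun j => c`_j *: bwd w j)).
rewrite (big_cat_nat (leq0n k.-1) (leq_pred k)) /= big_mkord.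
rewrite (@big_ltn _ _ _ k.-1) ?ltn_predL // big_geq ?prednK // addr0.
rewrite ck scale1r {2}/bwd ltnn addrC.
under [X in _ + X]eq_bigr => j _ do rewrite /bwd ltn_ord.
by rewrite subrK.
Qed.

Let winS n i : (i < k)%N -> win (n + 1) i = fwd (win n) i.
Proof.
case: n => [m|m] ik; first by rewrite -PoszD addn1.
have -> : Negz m + 1 = - m%:Z by rewrite NegzE -addn1 PoszD opprD addrNK.
rewrite [win (Negz m)]/= fwd_bwd //.
by case: m => [|m]; rewrite ?oppr0 // -NegzE.
Qed.

Let win_shift n i j : (i + j < k)%N -> win n (i + j) = win (n - i%:Z) j.
Proof.
elim: i n => [|i IH] n ik; first by rewrite subr0.
rewrite -[in LHS](subrK 1 n) winS // addSn /= IH ?(ltn_trans _ ik) //.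
by rewrite -addrA -opprD -PoszD add1n.
Qed.

Lemma recurrence_seq_exists : exists X, is_recurrence_seq c X.
Proof.
have k0 : (0 < k)%N by apply: ltn_trans k2.
exists (fun n => win n 0%N); split.
- by apply/rowP => j; rewrite !mxE.
- move=> i; have ik : (i.+1 + 0 < k)%N by have := ltn_ord i; rewrite addn0 -ltnS prednK.
  have := win_shift 0 ik; rewrite sub0r => <-.
  by apply/rowP => j; rewrite addn0 !mxE eqSS eqxx /= eq_sym.
- move=> n; rewrite -[in LHS](subrK 1 n) winS //=; apply: eq_bigr => i _.
  have ik : (i + 0 < k)%N by rewrite addn0.
  have := win_shift (n - 1) ik; rewrite addn0 => ->.
  by rewrite -addrA -opprD -PoszD add1n.
Qed.

End Existence.

(* Main.v *)
(* A finitely supported sequence is satisfying iff each of its length-k windows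
   is lexicographically smaller than c.
   Existence: start from any nonnegative representation. A window that is not
   smaller than c allows a carry which keeps the represented vector, does not
   increase the digit sum and, if it keeps the digit sum, increases the sequence
   lexicographically; such carries terminate.
   Uniqueness: with positive integers G_n = c_1 G_(n-1) + ... + c_k G_(n-k)
   (with an extra 1 for n < k), a satisfying sequence supported on 1, ..., N has
   0 <= sum a_n G_(N-n) < G_N, and it is determined by this sum, as in Zeckendorf
   numeration. The map X_(-n) |-> G_(N-n) is well defined modulo G_N, so
   the represented vector determines the sum. *)

Require Import Defs.
From mathcomp Require Import all_boot all_order all_algebra zify.
From Stdlib Require Import FunctionalExtensionality.

Set Implicit Arguments.
Unset Strict Implicit.
Unset Printing Implicit Defensive.

Import Order.TTheory GRing.Theory Num.Theory.
Local Open Scope ring_scope.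

(** * Linear combinations with polynomial coefficients *)

Section PolyEval.

Variables (R : comNzRingType) (V : lmodType R) (x : nat -> V).
Implicit Types p q : {poly R}.

(** Digit sequences are stored as polynomials: carries become polynomial identities, and [p.[1]] is
    the digit sum. *)
Definition poly_comb p : V := \sum_(i < size p) p`_i *: x i.

Lemma poly_combE p N : (size p <= N)%N ->
  poly_comb p = \sum_(i < N) p`_i *: x i.
Proof.
move=> pN; rewrite -(big_mkord xpredT (fun i => p`_i *: x i)).
rewrite (big_cat_nat (leq0n _) pN) /= big_mkord.
rewrite [X in _ + X]big_nat_cond [X in _ + X]big1 ?addr0 // => i /andP[/andP[pi _] _].
by rewrite nth_default ?scale0r.
Qed.

Lemma poly_combD p q : poly_comb (p + q) = poly_comb p + poly_comb q.
Proof.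
have pN := leq_maxl (size p) (size q); have qN := leq_maxr (size p) (size q).
rewrite (poly_combE pN) (poly_combE qN) (poly_combE (size_polyD p q)).
by rewrite -big_split; apply: eq_bigr => i _; rewrite coefD scalerDl.
Qed.

Lemma poly_combZ a p : poly_comb (a *: p) = a *: poly_comb p.
Proof.
rewrite (poly_combE (size_scale_leq a p)) scaler_sumr.
by apply: eq_bigr => i _; rewrite coefZ scalerA.
Qed.

Lemma poly_combB p q : poly_comb (p - q) = poly_comb p - poly_comb q.
Proof. by rewrite -(scaleN1r q) poly_combD poly_combZ scaleN1r. Qed.

Lemma poly_comb0 : poly_comb 0 = 0.
Proof. by rewrite /poly_comb size_poly0 big_ord0. Qed.

Lemma poly_combXn n : poly_comb 'X^n = x n.
Proof.
rewrite (@poly_combE _ n.+1) ?size_polyXn // big_ord_recr /= coefXn eqxx scale1r.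
by rewrite big1 ?add0r // => i _; rewrite coefXn ltn_eqF ?scale0r.
Qed.

Lemma poly_comb_XnM_Poly n (s : seq R) :
  poly_comb ('X^n * Poly s) = \sum_(i < size s) s`_i *: x (n + i)%N.
Proof.
have -> : Poly s = \sum_(i < size s) s`_i *: 'X^i.
  by rewrite -poly_def; apply/polyP => i; rewrite coef_Poly coef_poly; case: ltnP => // ?; rewrite nth_default.
rewrite mulr_sumr (big_morph _ poly_combD poly_comb0).
by apply: eq_bigr => i _; rewrite -scalerAr -exprD poly_combZ poly_combXn.
Qed.

End PolyEval.

(** * Termination of lexicographic increase at fixed digit sum *)

Definition lex_lt (p q : {poly int}) : Prop :=
  exists2 j, (forall i, (i < j)%N -> p`_i = q`_i) & p`_j < q`_j.

Definition nneg_poly (p : {poly int}) : Prop := forall i, 0 <= p`_i.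

Lemma nneg_poly_horner1 (p : {poly int}) :
  nneg_poly p -> 0 <= p.[1] /\ (p.[1] = 0 -> p = 0).
Proof.
move=> p0; rewrite horner_coef.
have t0 (i : 'I_(size p)) : xpredT i -> 0 <= p`_i * 1 ^+ i by rewrite expr1n mulr1.
split; first exact: sumr_ge0.
move/eqP; rewrite psumr_eq0 // => /allP s0; apply/polyP => i; rewrite coef0.
case: (ltnP i (size p)) => [ip|/(nth_default _)-> //].
by have := s0 (Ordinal ip) (mem_index_enum _); rewrite expr1n mulr1 => /eqP.
Qed.

(* A polynomial with coefficients in nat and sum of coefficients D is the
   nondecreasing D-tuple of its exponents; increasing it in lex_lt decreases
   that tuple lexicographically, which is well founded. *)
Lemma lex_lt_wf (D : nat) (P : {poly int} -> Prop) (Q : Prop) :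
  (forall p, P p -> nneg_poly p /\ p.[1] = D%:Z) ->
  (forall p, P p -> Q \/ exists2 q, P q & lex_lt p q) ->
  forall p, P p -> Q.
Proof.
elim: D P => [|D IH] P Pnn Pstep.
  have P0 p : P p -> p = 0 by case/Pnn => /nneg_poly_horner1[_ h] /h.
  move=> p Pp; case: (Pstep _ Pp) => // -[q /P0-> [j _]].
  by rewrite (P0 _ Pp) ltxx.
suff first_nz m p : P p -> 0 < p`_m -> Q.
  move=> p Pp; have [p0 p1] := Pnn _ Pp.
  have [/existsP[i pi]|/existsPn p_le0] := boolP [exists i : 'I_(size p), 0 < p`_i].
    exact: first_nz pi.
  suff p00 : p = 0 by move: p1; rewrite p00 horner0.
  apply/polyP => i; rewrite coef0; case: (ltnP i (size p)) => [ip|/(nth_default _)-> //].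
  by have := p_le0 (Ordinal ip); have := p0 i => /=; lia.
elim/ltn_ind: m p => m IHm p Pp pm.
(* One unit at [m] is set aside and the rest has digit sum [D]. An increase first occurring at
   [j < m] makes the coefficient at [j] positive, so the induction on [m] applies; any other
   increase leaves the unit at [m] in place. *)
apply: (IH (fun q => nneg_poly q /\ P ('X^m + q)) _ _ (p - 'X^m)).
- move=> q [q0 /Pnn[_]]; rewrite hornerD hornerXn expr1n => q1; split=> //; lia.
- move=> q [q0 Pq]; case: (Pstep _ Pq) => [|[r Pr [j qr_eq qr_lt]]]; first by left.
  have [r0 _] := Pnn _ Pr.
  have [jm|mj] := ltnP j m.
    left; apply: (IHm j jm r Pr); move: qr_lt; rewrite coefD coefXn; have := q0 j.
    by case: eqP => /=; lia.
  have rm : 0 < r`_m.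
    have qm : 0 < ('X^m + q)`_m by rewrite coefD coefXn eqxx; have := q0 m => /=; lia.
    have := mj; rewrite leq_eqVlt => /orP[/eqP mj_eq|/qr_eq <- //].
    by subst j; apply: lt_trans qm qr_lt.
  right; exists (r - 'X^m); first split.
  + by move=> i; rewrite coefB coefXn; case: eqP => [->|_]; rewrite ?subr0 // subr_ge0 -gtz0_ge1.
  + by rewrite addrC subrK.
  + exists j; last by rewrite coefB ltrBrDl -coefD.
    by move=> i /qr_eq; rewrite coefB coefD => <-; rewrite addrC addKr.
- split; last by rewrite addrC subrK.
  move=> i; rewrite coefB coefXn; have := (Pnn _ Pp).1 i.
  by case: eqP => [->|_]; rewrite ?subr0 // subr_ge0 -gtz0_ge1.
Qed.

(** * Satisfying sequences as a condition on windows *)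

Definition admissible (k : nat) (c : seq int) (a : nat -> nat) : Prop :=
  forall j, exists s, [/\ (s < k)%N, forall i, (i < s)%N -> (a (j + i)%N)%:Z = c`_i
    & (a (j + s)%N)%:Z < c`_s].

Lemma admissible_shift k c a m :
  admissible k c a -> admissible k c (fun n => a (m + n)%N).
Proof.
move=> adm j; have [t [tk t_eq t_lt]] := adm (m + j)%N.
by exists t; split=> // [i it|]; rewrite addnA // t_eq.
Qed.

Section NonincreasingDigits.

Variables (k : nat) (c : k.-tuple int).
Hypotheses (hk : (2 <= k)%N)
  (hc : forall i : nat, (i.+1 < k)%N -> c`_(i.+1) <= c`_i)
  (hck : c`_k.-1 = 1).

Lemma digits_default i : (k <= i)%N -> c`_i = 0.
Proof. by move=> ki; rewrite nth_default ?size_tuple. Qed.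

Lemma digits_gt0 i : (i < k)%N -> 0 < c`_i.
Proof.
move=> ik; have [d] : exists d, d = (k.-1 - i)%N by exists (k.-1 - i)%N.
elim: d i ik => [|d IH] i ik di.
  have -> : i = k.-1 by lia.
  by rewrite hck.
have ik' : (i.+1 < k)%N by lia.
by apply: lt_le_trans (hc ik'); apply: IH => //; lia.
Qed.

Lemma digits_anti i j : (i <= j)%N -> c`_j <= c`_i.
Proof.
elim: j => [|j IH]; first by rewrite leqn0 => /eqP->.
rewrite leq_eqVlt => /orP[/eqP-> //|ij].
case: (ltnP j.+1 k) => jk; first exact: le_trans (hc jk) (IH ij).
rewrite digits_default //; have [ik|ki] := ltnP i k; first exact/ltW/digits_gt0.
by rewrite digits_default.
Qed.

(** The window at 0 is a leading block with [l = 0], and admissibility passes to what follows it. *)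
Lemma admissible_satisfying N a : (forall n, (N <= n)%N -> a n = 0%N) ->
  admissible k c a -> satisfying c a.
Proof.
elim/ltn_ind: N a => N IH a aN adm.
have [N0|Npos] := posnP N; first by apply: SR_zero => n; apply: aN; rewrite N0.
have [s [sk a_eq a_lt]] := adm 0%N.
apply: (@SR_block _ _ a s 0) => //; first by lia.
apply: (IH N.-1); [by lia| by move=> n Nn; apply: aN; lia|].
exact: admissible_shift.
Qed.

(* Since c is nonincreasing, deleting leading digits from a prefix of c
   followed by a smaller digit keeps it lexicographically below c. *)
Lemma admissible_block (a : nat -> nat) s j : (s < k)%N ->
  (forall i, (i < s)%N -> (a i)%:Z = c`_i) -> (a s)%:Z < c`_s -> (j <= s)%N ->
  exists t, [/\ (t < k)%N, forall i, (i < t)%N -> (a (j + i)%N)%:Z = c`_i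
    & (a (j + t)%N)%:Z < c`_t].
Proof.
move=> sk a_eq a_lt js.
have ex : exists i, (a (j + i)%N)%:Z != c`_i.
  (* The digit [a s] lands at place [s - j], where [c] is at least [c_s], hence larger than
     [a s]. *)
  exists (s - j)%N; rewrite subnKC // lt_eqF //; apply: lt_le_trans a_lt _.
  exact/digits_anti/leq_subr.
case: (ex_minnP ex) => t at_neq t_min.
have t_le : (t <= s - j)%N.
  apply: t_min; rewrite subnKC // lt_eqF //; apply: lt_le_trans a_lt _.
  exact/digits_anti/leq_subr.
exists t; split; first by lia.
  by move=> i it; apply/eqP; apply: contraLR it => /t_min; rewrite -leqNgt.
rewrite lt_neqAle at_neq /=; apply: (@le_trans _ _ c`_(j + t)); last exact/digits_anti/leq_addl.
have [jts|jts] := ltnP (j + t) s; first by rewrite a_eq.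
have -> : (j + t)%N = s by lia.
exact: ltW.
Qed.

(** A window starting inside the leading block is covered by [admissible_block], one starting in the
    zero gap begins with a digit below [c_1], and later ones come from the induction. *)
Lemma satisfying_admissible a : satisfying c a -> admissible k c a.
Proof.
have zero j (b : nat -> nat) : b j = 0%N -> exists s, [/\ (s < k)%N,
    forall i, (i < s)%N -> (b (j + i)%N)%:Z = c`_i & (b (j + s)%N)%:Z < c`_s].
  move=> bj; exists 0%N; split=> //; first by lia.
  by rewrite addn0 bj digits_gt0 //; lia.
elim=> [{}a a0|{}a m mk _ am a_eq|{}a s l sk a_eq a_lt a0 _ IH] j; first exact/zero/a0.
  have [jm|jm] := leqP j m.+1; last by apply/zero/am/ltnW.
  (* A proper prefix of [c] is a block ended by the digit 0 at [m.+1], as [c] is positive there. *)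
  apply: (@admissible_block _ m.+1) => //.
  by rewrite am // digits_gt0.
have [js|sj] := leqP j s; first exact: (@admissible_block _ s).
have [jl|lj] := leqP j (s + l); first by apply/zero/a0; rewrite sj.
have [t [tk t_eq t_lt]] := IH (j - (s.+1 + l))%N; rewrite addnA subnKC // in t_lt.
by exists t; split=> // i /t_eq; rewrite addnA subnKC.
Qed.

(** * Integer weights and the associated numeration *)

(** The list holds G_(n-1), ..., G_0, latest first, so that structural recursion reaches the k
    preceding terms; the default 0 stands for terms of negative index. *)
Fixpoint weights (n : nat) : seq int :=
  if n is m.+1 then
    (\sum_(i < k) c`_i * (weights m)`_i + (m < k)%:R) :: weights m
  else [::].

Definition weight n := (weights n.+1)`_0.

Lemma nth_weights n i : (weights n)`_i = if (i < n)%N then weight (n.-1 - i) else 0.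
Proof.
elim: n i => [|n IH] [|i] //=; first by rewrite subn0.
by rewrite [LHS]IH ltnS; case: ltnP => // lin; congr weight; lia.
Qed.

Lemma weightE n : weight n =
  \sum_(i < k) c`_i * (if (i < n)%N then weight (n.-1 - i) else 0) + (n < k)%:R.
Proof.
rewrite [LHS]/=; congr (_ + _); apply: eq_bigr => i _.
by rewrite nth_weights.
Qed.

Lemma weight_small n : (n < k)%N ->
  weight n = \sum_(i < n) c`_i * weight (n.-1 - i) + 1.
Proof.
move=> nk; rewrite weightE nk; congr (_ + _).
rewrite (big_ord_widen _ (fun i => c`_i * weight (n.-1 - i)) (ltnW nk)) [RHS]big_mkcond.
by apply: eq_bigr => i _; case: ifP; rewrite ?mulr0.
Qed.

Lemma weight_large n : (k <= n)%N ->
  weight n = \sum_(i < k) c`_i * weight (n.-1 - i).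
Proof.
move=> kn; rewrite weightE ltnNge kn addr0; apply: eq_bigr => i _.
by rewrite (leq_trans (ltn_ord i) kn).
Qed.

Lemma weight_gt0 n : 0 < weight n.
Proof.
elim/ltn_ind: n => n IH; have [nk|kn] := ltnP n k.
  rewrite weight_small //; apply: ltr_wpDl => //; apply: sumr_ge0 => i _.
  apply: mulr_ge0; apply: ltW; last by apply: IH; have := ltn_ord i; lia.
  by apply: digits_gt0; apply: ltn_trans nk.
have k0 : (0 < k)%N by lia.
rewrite weight_large // (bigD1 (Ordinal k0)) //=; apply: ltr_wpDr.
  by apply: sumr_ge0 => i _; apply/ltW/mulr_gt0; rewrite ?digits_gt0 // IH //; lia.
by apply: mulr_gt0; rewrite ?digits_gt0 // IH //; lia.
Qed.

(** The left side is a partial sum of the recurrence for [weight n], whose terms are positive. *)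
Lemma weight_ge_prefix s n : (s < k)%N -> (s < n)%N ->
  \sum_(i < s.+1) c`_i * weight (n.-1 - i) <= weight n.
Proof.
move=> sk sn; pose F i := c`_i * weight (n.-1 - i).
have F0 i : (i < k)%N -> 0 <= F i.
  by move=> ik; apply/ltW/mulr_gt0; rewrite ?digits_gt0 ?weight_gt0.
have widen m : (s < m <= k)%N -> \sum_(i < s.+1) F i <= \sum_(i < m) F i.
  move=> /andP[sm mk]; rewrite (big_ord_widen _ F sm) [leLHS]big_mkcond.
  by apply: ler_sum => i _; case: ifP => // _; apply: F0; apply: leq_trans mk.
have [nk|kn] := ltnP n k; last by rewrite [leRHS]weight_large // widen // sk /=.
by rewrite [leRHS]weight_small //; apply: ler_wpDr => //; rewrite widen // sn ltnW.
Qed.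

Definition weight_sum (a : nat -> nat) N : int :=
  \sum_(n < N) (a n)%:Z * weight (N.-1 - n).

Lemma weight_sum_ge0 a N : 0 <= weight_sum a N.
Proof. by apply: sumr_ge0 => n _; apply: mulr_ge0 => //; apply/ltW/weight_gt0. Qed.

(** After the first block, the tail is worth less than one unit of the digit that is below [c_s].
    Raising that digit to [c_s] thus more than pays for the tail, and [weight_ge_prefix] bounds the
    result. *)
Lemma weight_sum_lt a N : admissible k c a ->
  (forall n, (N <= n)%N -> a n = 0%N) -> weight_sum a N < weight N.
Proof.
elim/ltn_ind: N a => N IH a adm aN; have [s [sk a_eq a_lt]] := adm 0%N.
(* If the support ends before the deficient digit, positivity of [c] forces [N = s]; strictness then
   comes from the extra 1 in [weight_small]. *)
have [sN|Ns] := ltnP s N; last first.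
  have {}Ns : (N = s)%N.
    apply/eqP; rewrite eqn_leq Ns leqNgt; apply/negP => Nlt.
    by have := a_eq _ Nlt; have := digits_gt0 (ltn_trans Nlt sk); rewrite aN // => /[swap] <-.
  subst s; rewrite [ltRHS]weight_small // ltzD1.
  by apply: ler_sum => i _; rewrite -a_eq.
have [M NE] : exists M, N = (s.+1 + M)%N by exists (N - s.+1)%N; lia.
subst N; apply: lt_le_trans (weight_ge_prefix sk sN).
have tail_lt : weight_sum (fun n => a (s.+1 + n)%N) M < weight M.
  apply: IH => [||n Mn]; [lia|exact: admissible_shift|apply: aN; lia].
rewrite /weight_sum big_split_ord /= big_ord_recr [ltRHS]big_ord_recr /= -addrA.
apply: ler_ltD; first by apply: ler_sum => i _; rewrite -a_eq.
have -> : \sum_(i < M) (a (s.+1 + i)%N)%:Z * weight (s + M - (s.+1 + i)) =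
    weight_sum (fun n => a (s.+1 + n)%N) M.
  by apply: eq_bigr => i _; congr (_ * weight _); lia.
rewrite addKn -ltrBDl -mulrBl; apply: lt_le_trans tail_lt _.
by apply: ler_peMl; [exact/ltW/weight_gt0|rewrite -gtz0_ge1 subr_gt0].
Qed.

Lemma weight_sum_inj a b N : admissible k c a -> admissible k c b ->
  (forall n, (N <= n)%N -> a n = 0%N) -> (forall n, (N <= n)%N -> b n = 0%N) ->
  weight_sum a N = weight_sum b N -> a =1 b.
Proof.
elim: N a b => [|N IH] a b adma admb aN bN ab n; first by rewrite aN // bN.
have shift f : weight_sum f N.+1 = (f 0%N)%:Z * weight N + weight_sum (fun n => f (1 + n)%N) N.
  rewrite /weight_sum big_ord_recl subn0; congr (_ + _).
  by apply: eq_bigr => i _; congr (_ * weight _); rewrite lift0; lia.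
have {}aN m : (N <= m)%N -> a (1 + m)%N = 0%N by move=> ?; apply: aN.
have {}bN m : (N <= m)%N -> b (1 + m)%N = 0%N by move=> ?; apply: bN.
have {}adma := admissible_shift 1 adma; have {}admb := admissible_shift 1 admb.
have ta := weight_sum_lt adma aN; have tb := weight_sum_lt admb bN.
have ta0 := weight_sum_ge0 (fun n => a (1 + n)%N) N.
have tb0 := weight_sum_ge0 (fun n => b (1 + n)%N) N.
have w0 := weight_gt0 N; move: ab; rewrite !shift => ab.
(* The leading digit is the quotient of the sum by [weight N], since both tails lie in [0,
   [weight N]). *)
have ab0 : a 0%N = b 0%N by nia.
case: n => [//|n]; apply: (IH _ _ adma admb aN bN).
by move: ab; rewrite ab0 => /addrI.
Qed.

(** * Uniqueness: weights of vectors modulo G_N *)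

Variable X : int -> 'rV[int]_k.-1.
Hypothesis hX : is_recurrence_seq c X.

(* Only modulo weight N, because X_0 = 0 whereas its weight is weight N. *)
Lemma recurrence_weight_mod N n : (k <= N)%N -> (n <= N)%N ->
  (weight N %| (X (- n%:Z) *m (\col_i weight (N.-1 - i))) 0%R 0%R - weight (N - n))%Z.
Proof.
(* [L] is the linear form taking the basis vector X_(-i) to G_(N-i). *)
move=> kN; pose L (v : 'rV[int]_k.-1) : int := (v *m (\col_i weight (N.-1 - i))) (0 : 'I_1) (0 : 'I_1).
rewrite -/(L _); have [X0 Xdelta Xrec] := hX.
elim/ltn_ind: n => n IH nN; have [nk|kn] := ltnP n k.
  case: n nk nN {IH} => [|n] nk nN.
    by rewrite oppr0 X0 /L mul0mx mxE sub0r subn0 rpredN dvdzz.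
  have nk1 : (n < k.-1)%N by lia.
  rewrite (Xdelta (Ordinal nk1)) /L -rowE !mxE /= (_ : N - n.+1 = N.-1 - n)%N; last by lia.
  by rewrite subrr dvdz0.
have klast : (k.-1 < k)%N by lia.
pose D m := L (X (- m%:Z)) - weight (N - m).
(* As [n <= N], the weight index N - (n - k) is at least k, so both terms of [D] obey the same
   homogeneous recurrence; [c_k = 1] then lets it be solved for [D n]. *)
have Drec : D (n - k)%N = \sum_(i < k) c`_i * D (n - k + i.+1)%N.
  rewrite /D Xrec (@weight_large (N - (n - k))); last by lia.
  rewrite {1}/L mulmx_suml summxE -sumrB; apply: eq_bigr => i _.
  rewrite -scalemxAl mxE -/(L _) mulrBr PoszD opprD; congr (_ - _ * weight _).
  by lia.
have Dn : D n = D (n - k)%N - \sum_(i < k | i != Ordinal klast) c`_i * D (n - k + i.+1)%N.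
  rewrite Drec (bigD1 (Ordinal klast)) //= addrK hck mul1r; congr D; lia.
rewrite -/(D n) Dn; apply: rpredB; first by apply: IH; lia.
apply: rpred_sum => i ilast; apply: dvdz_mull.
have ik : (i < k.-1)%N.
  by have := ltn_ord i; move: ilast; rewrite -val_eqE /=; lia.
by apply: IH; lia.
Qed.

Lemma repr_weight_mod N (a : nat -> nat) : (k <= N)%N ->
  (weight N %| ((\sum_(n < N) X (- (n.+1)%:Z) *+ a n) *m
    (\col_i weight (N.-1 - i))) 0%R 0%R - weight_sum a N)%Z.
Proof.
move=> kN; rewrite mulmx_suml summxE -sumrB; apply: rpred_sum => n _.
rewrite -scaler_nat -scalemxAl mxE natz -mulrBr; apply: dvdz_mull.
rewrite (_ : N.-1 - n = N - n.+1)%N; last by lia.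
exact: recurrence_weight_mod.
Qed.

Lemma satisfying_repr_widen v a : satisfying_repr c X v a ->
  exists M, forall N, (M <= N)%N ->
    (forall n, (N <= n)%N -> a n = 0%N) /\ v = \sum_(n < N) X (- (n.+1)%:Z) *+ a n.
Proof.
move=> [_ [M [aM ->]]]; exists M => N MN; split=> [n Nn|]; first exact/aM/(leq_trans MN).
rewrite (big_ord_widen _ (fun n => X (- (n.+1)%:Z) *+ a n) MN) big_mkcond.
by apply: eq_bigr => n _; case: ltnP => // /aM->.
Qed.

Lemma satisfying_repr_unique v a b :
  satisfying_repr c X v a -> satisfying_repr c X v b -> a = b.
Proof.
move=> va vb; apply: functional_extensionality.
have [Ma /(_ (k + Ma + _))%N aN] := satisfying_repr_widen va.
have [Mb /(_ (k + _ + Mb))%N bN] := satisfying_repr_widen vb.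
have {aN} [|aN va_sum] := aN Mb; first by lia.
have {bN} [|bN vb_sum] := bN Ma; first by lia.
set N := (k + Ma + Mb)%N in aN va_sum bN vb_sum.
have adma := satisfying_admissible va.1; have admb := satisfying_admissible vb.1.
apply: (weight_sum_inj adma admb aN bN); apply/eqP; rewrite -subr_eq0.
have kN : (k <= N)%N by lia.
(* The two weight sums are congruent modulo [weight N] and both lie in [0, [weight N]), hence are
   equal. *)
have := rpredB (repr_weight_mod b kN) (repr_weight_mod a kN).
rewrite -va_sum -vb_sum opprB addrC addrA subrK => /dvdzP[q qE]; rewrite qE mulf_eq0.
have := weight_sum_lt adma aN; have := weight_sum_lt admb bN.
have := weight_sum_ge0 a N; have := weight_sum_ge0 b N.
move=> b0 a0 b_lt a_lt; have : `|q * weight N| < weight N by rewrite -qE; lia.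
rewrite normrM (gtr0_norm (weight_gt0 N)) gtr_pMl ?weight_gt0 // => q_lt.
by apply/orP; left; lia.
Qed.

(** * Existence: carries on nonnegative representations *)

Let digit_poly : {poly int} := Poly c.
Let value := poly_comb (fun n => X (- (n.+1)%:Z)).

(** This is the recurrence at index -j: the digits of [c] from position [j] on can be traded for a
    single X_(-j). *)
Lemma value_XnM_digit_poly j : value ('X^j * digit_poly) = X (- j%:Z).
Proof.
rewrite /value poly_comb_XnM_Poly size_tuple; have [_ _ ->] := hX.
by apply: eq_bigr => i _; rewrite -addnS PoszD opprD.
Qed.

(** This makes a full carry, which trades [c] for at most one unit, lower the digit sum. *)
Lemma digit_poly_horner1 : 2 <= digit_poly.[1].
Proof.
have horner1 : digit_poly.[1] = \sum_(i < k) c`_i.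
  rewrite (@horner_coef_wide _ k) ?(leq_trans (size_Poly _)) ?size_tuple //.
  by apply: eq_bigr => i _; rewrite coef_Poly expr1n mulr1.
have c1 i : (i < k)%N -> 1 <= c`_i by move=> ik; rewrite -gtz0_ge1 digits_gt0.
rewrite horner1; apply: (@le_trans _ _ (\sum_(i < k) 1)).
  by rewrite sumr_const card_ord (ler_nat int 2 k).
by apply: ler_sum => i _; apply: c1.
Qed.

(** X_(-j) sits at position j - 1; at j = 0 the carried unit disappears because X_0 = 0. *)
Definition carry j : {poly int} := if j is i.+1 then 'X^i else 0.

Lemma value_carry j : value (carry j) = X (- j%:Z).
Proof.
case: j => [|j]; last exact: poly_combXn.
by rewrite /value poly_comb0; have [-> _ _] := hX.
Qed.

Lemma carry_horner1 j : (carry j).[1] = (0 < j)%:R.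
Proof. by case: j => [|j]; rewrite ?horner0 // hornerXn expr1n. Qed.

Lemma coef_carry j n : (carry j)`_n = (j == n.+1)%:R.
Proof. by case: j => [|j]; rewrite ?coef0 // coefXn eqSS eq_sym. Qed.

Definition carry_decreases (q p : {poly int}) : Prop :=
  q.[1] < p.[1] \/ q.[1] = p.[1] /\ lex_lt p q.

Lemma carry_full p j : nneg_poly p -> (forall i, (i < k)%N -> c`_i <= p`_(j + i)) ->
  exists q, [/\ nneg_poly q, value q = value p & carry_decreases q p].
Proof.
move=> p0 p_ge; exists (p + carry j - 'X^j * digit_poly); split.
- move=> n; rewrite coefB coefD coef_carry coefXnM coef_Poly.
  have [nj|jn] := ltnP n j; first by rewrite subr0 addr_ge0 ?p0 // ler0n.
  rewrite ltn_eqF ?addr0 ?subr_ge0 //.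
  have [nk|kn] := ltnP (n - j) k; first by rewrite -{2}(subnKC jn) p_ge.
  by rewrite digits_default.
- by rewrite /value poly_combB poly_combD -/value value_carry value_XnM_digit_poly addrK.
- left; rewrite hornerD hornerN hornerD hornerM hornerXn expr1n mul1r carry_horner1.
  rewrite -addrA gtrDl subr_lt0; apply: lt_le_trans digit_poly_horner1.
  by case: (0 < j)%N.
Qed.

(* Lower the window by the digits c_1, ..., c_k and one more unit at its s-th
   place, carry 1 in front of it, and expand that unit into c_1, ..., c_k just
   after the s-th place: the balance at the later places is c_(i-s) - c_i >= 0. *)
Lemma carry_partial p j s : nneg_poly p -> (s < k)%N ->
  (forall i, (i < s)%N -> c`_i <= p`_(j + i)) -> c`_s < p`_(j + s) ->
  exists q, [/\ nneg_poly q, value q = value p & carry_decreases q p].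
Proof.
move=> p0 sk p_ge p_gt; have c0 i : 0 <= c`_i.
  have [ik|ki] := ltnP i k; first exact/ltW/digits_gt0.
  by rewrite digits_default.
pose d : {poly int} := 'X^j * digit_poly + 'X^(j + s) - 'X^(j + s.+1) * digit_poly.
exists (p + carry j - d); split.
- move=> n; rewrite coefB coefD coef_carry /d coefB coefD !coefXnM coefXn !coef_Poly.
  have [nj|jn] := ltnP n j.
    rewrite [(n < j + s.+1)%N]ltn_addr; last by lia.
    rewrite [n == _]ltn_eqF; last by lia.
    by rewrite subr0 addr_ge0 ?p0 // ler0n.
  rewrite ltn_eqF // addr0; have [i nE] : exists i, n = (j + i)%N by exists (n - j)%N; lia.
  subst n; rewrite addKn ltn_add2l eqn_add2l ltnS.
  have [si|is_|si] := ltngtP s i.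
  - rewrite addr0 (_ : j + i - (j + s.+1) = i - s.+1)%N; last by lia.
    by rewrite opprB addr_ge0 ?p0 // subr_ge0 digits_anti // leq_subr.
  - by rewrite addr0 subr0 subr_ge0 p_ge.
  - by subst i; rewrite subr0 subr_ge0 addrC lez1D.
- rewrite /value /d !(poly_combB, poly_combD) poly_combXn -/value.
  rewrite !value_XnM_digit_poly value_carry addnS addrK; exact: addrK.
- rewrite /carry_decreases !(hornerD, hornerN, hornerM, hornerXn) !expr1n !mul1r carry_horner1.
  (* Here [d] has digit sum 1. At [j = 0] nothing is carried, so the digit sum drops; otherwise it
     is kept and the first change is an increase at [j.-1]. *)
  have [j0|j0] := posnP j; first by left; rewrite addr0 addrAC subrr add0r ltrBlDr ltrDl.
  right; split; first by rewrite [X in _ - X]addrAC subrr add0r addrK.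
  exists j.-1 => [i ij|].
    rewrite /d coefB coefD coef_carry coefB coefD !coefXnM coefXn.
    rewrite !ifT; [|lia|lia].
    rewrite [i == _]ltn_eqF ?[j == _]gtn_eqF; [|lia|lia].
    by rewrite !(addr0, subr0).
  rewrite /d coefB coefD coef_carry coefB coefD !coefXnM coefXn.
  rewrite !ifT; [|lia|lia].
  rewrite prednK // eqxx [j.-1 == _]ltn_eqF; last by lia.
  by rewrite !(addr0, subr0) ltrDl.
Qed.

Lemma window_trichotomy (w : nat -> int) :
  [\/ exists s, [/\ (s < k)%N, forall i, (i < s)%N -> w i = c`_i & w s < c`_s],
      exists s, [/\ (s < k)%N, forall i, (i < s)%N -> c`_i <= w i & c`_s < w s]
    | forall i, (i < k)%N -> c`_i <= w i].
Proof.
have [/existsP ex|/existsPn w_eq] := boolP [exists i : 'I_k, w i != c`_i]; last first.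
  by constructor 3 => i ik; have /negPn/eqP-> := w_eq (Ordinal ik).
have {}ex : exists i, (i < k)%N && (w i != c`_i).
  by have [i wi] := ex; exists i; rewrite ltn_ord.
case: (ex_minnP ex) => s /andP[sk ws] s_min.
have w_eq i : (i < s)%N -> w i = c`_i.
  move=> i_s; apply/eqP; apply: contraLR i_s => wi; rewrite -leqNgt.
  have [ik|ki] := ltnP i k; first by rewrite s_min // ik.
  exact: leq_trans (ltnW sk) ki.
move: ws; rewrite neq_lt => /orP[ws|ws]; first by constructor 1; exists s.
by constructor 2; exists s; split=> // i /w_eq->.
Qed.

Lemma admissible_or_carry p : nneg_poly p ->
  admissible k c (fun n => absz p`_n) \/
  exists q, [/\ nneg_poly q, value q = value p & carry_decreases q p].
Proof.
(* Windows are scanned from the left; those starting at [size p] or later begin with 0 and need no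
   carry. *)
move=> p0; suff step M : (forall j, (j < M)%N -> exists s, [/\ (s < k)%N,
    forall i, (i < s)%N -> p`_(j + i) = c`_i & p`_(j + s) < c`_s]) \/
  exists q, [/\ nneg_poly q, value q = value p & carry_decreases q p].
  have [adm|] := step (size p); [left=> j|by right].
  have [/adm [s [sk w_eq w_lt]]|pj] := ltnP j (size p).
    by exists s; split=> // [i it|]; rewrite gez0_abs // w_eq.
  exists 0%N; split=> //; first by lia.
  by rewrite addn0 nth_default // digits_gt0 //; lia.
elim: M => [|M [IH|]]; [by left| |by right].
case: (window_trichotomy (fun i => p`_(M + i))) => [adm|[s [sk ge gt]]|ge].
- left=> j; rewrite ltnS leq_eqVlt => /orP[/eqP-> //|]; exact: IH.
- by right; apply: carry_partial ge gt.
- by right; apply: carry_full ge.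
Qed.

Lemma satisfying_repr_poly p : nneg_poly p -> exists a, satisfying_repr c X (value p) a.
Proof.
move=> p0; have [p1 _] := nneg_poly_horner1 p0.
have [D pD] : exists D : nat, p.[1] = D%:Z by exists (absz p.[1]); rewrite gez0_abs.
elim/ltn_ind: D p p0 {p1} pD => D IH p p0 pD.
(* Carries keeping the digit sum stay in [P] and terminate by [lex_lt_wf]; one lowering it is
   settled by the induction on [D]. *)
pose P q := [/\ nneg_poly q, q.[1] = D%:Z & value q = value p].
apply: (@lex_lt_wf D P _ _ _ p) => // q; first by case.
move=> [q0 qD qp]; case: (admissible_or_carry q0) => [adm|[r [r0 rq]]].
  left; exists (fun n => absz q`_n); split.
    by apply: (@admissible_satisfying (size q)) => // n qn; rewrite nth_default.
  exists (size q); split=> [n qn|]; first by rewrite nth_default.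
  rewrite -qp; apply: eq_bigr => n _.
  by rewrite -scaler_nat natz gez0_abs.
case=> [r_lt|[r_eq r_lex]]; last by right; exists r => //; split; rewrite ?r_eq ?rq.
have [r1 _] := nneg_poly_horner1 r0.
left; rewrite -qp -rq; apply: (IH (absz r.[1])) => //; last by rewrite gez0_abs.
by rewrite -ltz_nat gez0_abs // -qD.
Qed.

Lemma value_rVpoly (v : 'rV[int]_k.-1) : value (rVpoly v) = v.
Proof.
rewrite /value (@poly_combE _ _ _ _ k.-1) ?size_poly //.
have [_ Xdelta _] := hX; rewrite [RHS]row_sum_delta.
by apply: eq_bigr => i _; rewrite Xdelta coef_rVpoly_ord.
Qed.

Lemma satisfying_repr_exists v : exists a, satisfying_repr c X v a.
Proof.
(* Since X_0 = 0, [digit_poly] has value 0. Its first k - 1 coefficients are at least 1, so adding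
   it [M] times makes every coordinate of [v] nonnegative. *)
pose M : int := \sum_i `|v 0 i|.
have vM : value (rVpoly v + M *: digit_poly) = v.
  have [X0 _ _] := hX; have := value_XnM_digit_poly 0; rewrite expr0 mul1r oppr0 X0 => C0.
  by rewrite /value poly_combD poly_combZ -/value C0 value_rVpoly scaler0 addr0.
rewrite -vM; apply: satisfying_repr_poly => n.
have M0 : 0 <= M by apply: sumr_ge0.
have c0 : 0 <= c`_n.
  have [nk|kn] := ltnP n k; first exact/ltW/digits_gt0.
  by rewrite digits_default.
rewrite coefD coefZ coef_Poly; have [nk|kn] := ltnP n k.-1; last first.
  by rewrite nth_default ?add0r ?mulr_ge0 // (leq_trans (size_poly _ _)).
rewrite (coef_rVpoly_ord v (Ordinal nk)).
have vM0 : `|v 0 (Ordinal nk)| <= M.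
  by rewrite /M (bigD1 (Ordinal nk)) //= ler_wpDr // sumr_ge0.
have Mc : M <= M * c`_n by rewrite ler_peMr // -gtz0_ge1 digits_gt0 //; lia.
rewrite -lerBlDl sub0r; apply: le_trans Mc; apply: le_trans vM0.
by rewrite -normrN ler_norm.
Qed.

End NonincreasingDigits.

Theorem theorem1p10 (k : nat) (c : k.-tuple int) (X : int -> 'rV[int]_k.-1)
  (hk : (2 <= k)%N)
  (hc : forall i : nat, (i.+1 < k)%N -> c`_(i.+1) <= c`_i)
  (hck : c`_k.-1 = 1)
  (hX : is_recurrence_seq c X) :
  forall v : 'rV[int]_k.-1, exists! a : nat -> nat, satisfying_repr c X v a.
Proof.
move=> v; have [a va] := satisfying_repr_exists hk hc hck hX v.
by exists a; split=> // b; apply: (satisfying_repr_unique hk hc hck hX va).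
Qed.
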